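(* Let $\alpha,\beta,\gamma,\mu,\nu,\kappa,D$ be real constants with $\nu\neq0$, $\alpha=\beta=\gamma=0$ and $\kappa=D^2$. Let $I\subset\mathbb{R}$ be an open interval and $H\in C^4(I)$ a real-valued function. Then $u(x,t)=H(x-Dt)$ is a solution, on the set $\{(x,t)\in\mathbb{R}^2: x-Dt\in I\}$, of $$u_{tt}=(\kappa u+\gamma u^2)_{xx}+\nu u u_{xxxx}+\mu u_{xxtt}+\alpha u_xu_{xxx}+\beta u_{xx}^2$$ if and only if there are real constants $C_0,C_1,C_2,C_3$ such that $$u(x,t)=C_0+C_1(x-Dt)+C_2(x-Dt)^2+C_3(x-Dt)^3 .$$
   Context: Subscripts denote partial derivatives of $u=u(x,t)$. Solutions of the form $u(x,t)=H(x-Dt)$ are travelling wave solutions with constant phase velocity $D$. For $u(x,t)=H(x-Dt)$ the partial derivatives are understood through $H$: $u_x=H'$, $u_{tt}=D^2H''$, $u_{xxtt}=D^2H^{(4)}$, etc., evaluated at $x-Dt$. *)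

(* Defs.v *)
From Stdlib Require Import Reals.
From Coquelicot Require Import Coquelicot.
Open Scope R_scope.

(* Open interval ]a, b[, bounded or not. *)
Definition Ioo (a b : Rbar) (x : R) : Prop :=
  Rbar_lt a x /\ Rbar_lt x b.

(* [I] is meant to be open, so that the derivatives at points of [I] depend
   only on the values of [f] on [I]. *)
Definition Cn_on (n : nat) (I : R -> Prop) (f : R -> R) : Prop :=
  forall k : nat, (k <= n)%nat -> forall x : R, I x ->
    ex_derive_n f k x /\ continuous (Derive_n f k) x.

Definition dx (n : nat) (u : R -> R -> R) : R -> R -> R :=
  fun x t => Derive_n (fun y => u y t) n x.

Definition dt (n : nat) (u : R -> R -> R) : R -> R -> R :=
  fun x t => Derive_n (fun s => u x s) n t.

(* u_tt = (kappa u + gamma u^2)_xx + nu u u_xxxx + mu u_xxtt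
          + alpha u_x u_xxx + beta u_xx^2   on Omega.
   [Derive_n] is total, so this is the intended notion for functions [u]
   having the partial derivatives that occur, as is the case on an open
   [Omega] when [u] is C^4 there. *)
Definition is_solution (alpha beta gamma mu nu kappa : R)
    (Omega : R -> R -> Prop) (u : R -> R -> R) : Prop :=
  forall x t : R, Omega x t ->
    dt 2 u x t =
      dx 2 (fun y s => kappa * u y s + gamma * u y s ^ 2) x t
      + nu * u x t * dx 4 u x t
      + mu * dt 2 (dx 2 u) x t
      + alpha * dx 1 u x t * dx 3 u x t
      + beta * dx 2 u x t ^ 2.

Definition travelling_wave (D : R) (H : R -> R) : R -> R -> R :=
  fun x t => H (x - D * t).

(* Main.v *)
Require Import Defs.
From Stdlib Require Import Reals Lra Lia.
From Coquelicot Require Import Coquelicot.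
Open Scope R_scope.

(** Inserting $u=H(x-Dt)$ and using $\kappa=D^2$, the terms $D^2H''$ on the two sides cancel,
    leaving the ODE $(\nu H+\mu D^2)H''''=0$ on $I$. The chain rules [dx_travelling_wave] and
    [dt_travelling_wave] give this reduction. The second factor must vanish everywhere: near a point
    with $H''''\neq0$ the first factor would be zero, so $H=-\mu D^2/\nu$ would be constant there
    and $H''''=0$ after all ([affine_mul_Derive_n_4_zero]). On an interval $H''''=0$ characterises
    the cubics ([Derive_n_4_zero_iff_cubic]), and a cubic clearly satisfies the ODE. *)

Lemma open_Ioo (a b : Rbar) : open (Ioo a b).
Proof. apply open_and; [apply open_Rbar_gt | apply open_Rbar_lt]. Qed.

Lemma locally_Ioo (a b : Rbar) (x : R) : Ioo a b x -> locally x (Ioo a b).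
Proof. apply (open_Ioo a b). Qed.

Lemma Ioo_convex (a b : Rbar) (x y z : R) :
  Ioo a b x -> Ioo a b y -> Rmin x y <= z <= Rmax x y -> Ioo a b z.
Proof.
unfold Ioo, Rmin, Rmax; destruct (Rle_dec x y); destruct a, b; simpl;
  intuition lra.
Qed.

(** The difference $f-g$ has zero derivative, so the mean value theorem applies on the segment from
    a base point to $x$, which stays inside the interval by convexity. *)
Lemma is_derive_eq_Ioo (a b : Rbar) (f g h : R -> R) :
  (forall x, Ioo a b x -> is_derive f x (h x)) ->
  (forall x, Ioo a b x -> is_derive g x (h x)) ->
  exists c : R, forall x, Ioo a b x -> f x = c + g x.
Proof.
intros Hf Hg.
(* The bounds may describe an empty interval, which has no base point; any constant then works. *)
destruct (Classical_Prop.classic (exists p, Ioo a b p)) as [[p Hp] | Hne].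
2: { exists 0; intros x Hx; elim Hne; now exists x. }
exists (f p - g p); intros x Hx.
assert (Hd : forall z, Rmin p x <= z <= Rmax p x ->
          is_derive (fun y => f y - g y) z 0).
{ intros z Hz. assert (Iz := Ioo_convex a b p x z Hp Hx Hz).
  replace 0 with (minus (h z) (h z)) by apply Rminus_diag.
  apply (is_derive_minus f g); auto. }
destruct (MVT_gen (fun y => f y - g y) p x (fun _ => 0)) as [c [_ Hc]].
- intros z Hz; apply Hd; lra.
- intros z Hz; apply continuity_pt_filterlim.
  apply (ex_derive_continuous (fun y => f y - g y)); eexists; now apply Hd.
- lra.
Qed.

Lemma is_derive_Derive_n (f : R -> R) (k : nat) (x : R) :
  ex_derive_n f (S k) x -> is_derive (Derive_n f k) x (Derive_n f (S k) x).
Proof. exact (Derive_correct (Derive_n f k) x). Qed.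

Lemma Cn_on_Derive_n (m k : nat) (I : R -> Prop) (f : R -> R) :
  Cn_on (m + k) I f -> Cn_on m I (Derive_n f k).
Proof.
intros Hf j Hj x Ix.
destruct (Hf (j + k)%nat ltac:(lia) x Ix) as [He Hc]; split.
- destruct j; [exact Logic.I|]. simpl in *.
  apply (ex_derive_ext (Derive_n f (j + k))); auto.
  intros t; symmetry; apply Derive_n_comp.
- apply (continuous_ext (Derive_n f (j + k))); auto.
  intros t; symmetry; apply Derive_n_comp.
Qed.

(** Forward, integrate four times, gaining one constant each time; backward, differentiate the
    polynomial. *)
Lemma Derive_n_4_zero_iff_cubic (a b : Rbar) (f : R -> R) :
  Cn_on 4 (Ioo a b) f ->
  (forall z, Ioo a b z -> Derive_n f 4 z = 0) <->
  exists C0 C1 C2 C3 : R, forall z, Ioo a b z ->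
    f z = C0 + C1 * z + C2 * z ^ 2 + C3 * z ^ 3.
Proof.
intros Hf; split.
- intros H4.
  assert (Hd : forall k, (k < 4)%nat -> forall z, Ioo a b z ->
            is_derive (Derive_n f k) z (Derive_n f (S k) z)).
  { intros k Hk z Hz; apply is_derive_Derive_n; apply (Hf (S k)); auto. }
  (* One integration: [P] is an antiderivative of the formula [Q] already found for the next higher
     derivative. The factors 1/2 and 1/6 below arise from these antiderivatives. *)
  assert (step : forall k P Q, (k < 4)%nat ->
            (forall z, Ioo a b z -> Derive_n f (S k) z = Q z) ->
            (forall z, is_derive P z (Q z)) ->
            exists c, forall z, Ioo a b z -> Derive_n f k z = c + P z).
  { intros k P Q Hk HQ HP; apply (is_derive_eq_Ioo a b _ P Q); auto.
    intros z Hz; rewrite <- HQ by auto; auto. }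
  destruct (step 3%nat (fun _ => 0) (fun _ => 0)) as [c3 H3]; auto.
  { intros z; auto_derive; auto. }
  destruct (step 2%nat (fun z => c3 * z) _ ltac:(auto) H3) as [c2 H2].
  { intros z; auto_derive; auto; ring. }
  destruct (step 1%nat (fun z => c2 * z + c3 / 2 * z ^ 2) _ ltac:(auto) H2)
    as [c1 H1].
  { intros z; auto_derive; auto; field. }
  destruct (step 0%nat (fun z => c1 * z + c2 / 2 * z ^ 2 + c3 / 6 * z ^ 3) _
    ltac:(lia) H1) as [c0 H0].
  { intros z; auto_derive; auto; field. }
  exists c0, c1, (c2 / 2), (c3 / 6); intros z Hz.
  change (f z) with (Derive_n f 0 z); rewrite H0 by auto; ring.
- intros (C0 & C1 & C2 & C3 & E) z Hz.
  (* [f] agrees with the cubic only on the interval, but openness makes this agreement local at [z],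
     which is all that derivatives see. *)
  rewrite (Derive_n_ext_loc f (fun y => C0 + C1 * y + C2 * y ^ 2 + C3 * y ^ 3)).
  2: { apply (filter_imp (Ioo a b)); auto; now apply locally_Ioo. }
  set (P := fun y => _).
  assert (D1 : forall y, Derive_n P 1 y = C1 + 2 * C2 * y + 3 * C3 * y ^ 2).
  { intros y; apply is_derive_unique; unfold P; auto_derive; auto; ring. }
  assert (D2 : forall y, Derive_n P 2 y = 2 * C2 + 6 * C3 * y).
  { intros y; change (Derive (Derive_n P 1) y = 2 * C2 + 6 * C3 * y).
    rewrite (Derive_ext _ _ y D1).
    apply is_derive_unique; auto_derive; auto; ring. }
  assert (D3 : forall y, Derive_n P 3 y = 6 * C3).
  { intros y; change (Derive (Derive_n P 2) y = 6 * C3).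
    rewrite (Derive_ext _ _ y D2).
    apply is_derive_unique; auto_derive; auto; ring. }
  change (Derive (Derive_n P 3) z = 0).
  rewrite (Derive_ext _ _ z D3); apply Derive_const.
Qed.

Lemma dx_travelling_wave (D : R) (f : R -> R) (n : nat) (x t : R) :
  dx n (travelling_wave D f) x t = Derive_n f n (x - D * t).
Proof. exact (Derive_n_comp_trans f n x (- (D * t))). Qed.

(** For fixed [x], the map $s\mapsto f(x-Ds)$ is a translate of [f] composed with scaling by $-D$;
    each time derivative contributes a factor $-D$. *)
Lemma dt_travelling_wave (a b : Rbar) (D : R) (f : R -> R) (n : nat) (x t : R) :
  Cn_on n (Ioo a b) f -> Ioo a b (x - D * t) ->
  dt n (travelling_wave D f) x t = (- D) ^ n * Derive_n f n (x - D * t).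
Proof.
intros Hf Hz; unfold dt, travelling_wave.
rewrite (Derive_n_ext _ (fun s => (fun y => f (y + x)) (- D * s)))
  by (intros s; f_equal; ring).
rewrite (Derive_n_comp_scal (fun y => f (y + x))).
- rewrite Derive_n_comp_trans.
  now replace (- D * t + x) with (x - D * t) by ring.
(* The scaling rule asks for differentiability in a neighbourhood of $-Dt$, obtained by pulling the
   open interval back along the translation. *)
- assert (L : locally (- D * t) (fun y => Ioo a b (y + x))).
  { apply (open_comp (fun y => y + x) (Ioo a b)).
    - intros y _; apply (continuous_plus (fun y => y) (fun _ => x)).
      + apply continuous_id.
      + apply continuous_const.
    - apply open_Ioo.
    - now replace (- D * t + x) with (x - D * t) by ring. }
  revert L; apply filter_imp; intros y Hy k Hk.
  apply ex_derive_n_comp_trans; now apply (Hf k).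
Qed.

(* Where [Derive_n f 4] does not vanish, continuity keeps it nonzero nearby,
   so there [c * f + d] vanishes identically and [f] is locally constant. *)
Lemma affine_mul_Derive_n_4_zero (a b : Rbar) (c d : R) (f : R -> R) :
  c <> 0 -> Cn_on 4 (Ioo a b) f ->
  (forall z, Ioo a b z -> (c * f z + d) * Derive_n f 4 z = 0) ->
  forall z, Ioo a b z -> Derive_n f 4 z = 0.
Proof.
intros hc Hf E z Hz.
destruct (Req_dec (Derive_n f 4 z) 0) as [|N]; [assumption|].
assert (L : locally z (fun y => Derive_n f 4 y <> 0)).
{ destruct (Hf 4%nat (le_n 4) z Hz) as [_ Hc].
  apply (Hc (fun v => v <> 0)); now apply (open_neq 0). }
rewrite (Derive_n_ext_loc f (fun _ => - d / c)).
- now rewrite Derive_n_const.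
- apply (filter_imp (fun y => Ioo a b y /\ Derive_n f 4 y <> 0)).
  + intros y [Iy Ny].
    destruct (Rmult_integral _ _ (E y Iy)) as [Z|]; [|easy].
    apply (Rmult_eq_reg_l c); [field_simplify; [lra|easy]|easy].
  + apply filter_and; [now apply locally_Ioo | exact L].
Qed.

Theorem mainTheorem3 (alpha beta gamma mu nu kappa D : R)
    (hnu : nu <> 0) (halpha : alpha = 0) (hbeta : beta = 0) (hgamma : gamma = 0)
    (hkappa : kappa = D ^ 2)
    (a b : Rbar) (H : R -> R) (hH : Cn_on 4 (Ioo a b) H) :
  is_solution alpha beta gamma mu nu kappa
    (fun x t => Ioo a b (x - D * t)) (travelling_wave D H)
  <->
  exists C0 C1 C2 C3 : R, forall x t : R, Ioo a b (x - D * t) ->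
    travelling_wave D H x t =
      C0 + C1 * (x - D * t) + C2 * (x - D * t) ^ 2 + C3 * (x - D * t) ^ 3.
Proof.
assert (ode : is_solution alpha beta gamma mu nu kappa
          (fun x t => Ioo a b (x - D * t)) (travelling_wave D H) <->
        forall x t, Ioo a b (x - D * t) ->
          (nu * H (x - D * t) + mu * D ^ 2) * Derive_n H 4 (x - D * t) = 0).
{ assert (pde : forall x t, Ioo a b (x - D * t) ->
    dt 2 (travelling_wave D H) x t = D ^ 2 * Derive_n H 2 (x - D * t) /\
    dx 2 (fun y s => kappa * travelling_wave D H y s
                     + gamma * travelling_wave D H y s ^ 2) x t
      = D ^ 2 * Derive_n H 2 (x - D * t) /\
    dt 2 (dx 2 (travelling_wave D H)) x t = D ^ 2 * Derive_n H 4 (x - D * t)).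
  { intros x t Hz; split; [|split].
    - rewrite (dt_travelling_wave a b); [ring| |easy].
      intros k Hk; apply hH; lia.
    - rewrite <- dx_travelling_wave, <- hkappa; unfold dx.
      rewrite <- Derive_n_scal_l.
      apply Derive_n_ext; intros y; rewrite hgamma; ring.
    (* $u_{xx}$ is itself a travelling wave, with profile $H''$ of class $C^2$, so the time rule
       applies to it. *)
    - transitivity (dt 2 (travelling_wave D (Derive_n H 2)) x t).
      + apply Derive_n_ext; intros s; apply dx_travelling_wave.
      + rewrite (dt_travelling_wave a b);
          [|now apply (Cn_on_Derive_n 2 2)|easy].
        rewrite Derive_n_comp; simpl Nat.add; ring. }
  unfold is_solution; split; intros E x t Hz; specialize (E x t Hz);
    destruct (pde x t Hz) as (p1 & p2 & p3); revert E;
    rewrite p1, p2, p3, halpha, hbeta, dx_travelling_wave;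
    unfold travelling_wave; intros E; lra. }
rewrite ode; split.
- intros E.
  assert (H4 : forall z, Ioo a b z -> Derive_n H 4 z = 0).
  { apply (affine_mul_Derive_n_4_zero a b nu (mu * D ^ 2)); auto.
    (* The slice $t=0$ already reaches every point of the interval. *)
    intros z Hz; specialize (E z 0).
    replace (z - D * 0) with z in E by ring; auto. }
  apply (Derive_n_4_zero_iff_cubic a b H hH) in H4.
  destruct H4 as (C0 & C1 & C2 & C3 & P).
  exists C0, C1, C2, C3; intros x t; apply P.
- intros (C0 & C1 & C2 & C3 & P) x t Hz.
  rewrite (proj2 (Derive_n_4_zero_iff_cubic a b H hH)); [ring| |easy].
  exists C0, C1, C2, C3; intros z Iz; specialize (P z 0).
  unfold travelling_wave in P.
  replace (z - D * 0) with z in P by ring; auto.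
Qed.
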